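(* If $X$ is a star Menger space and $Y$ is a $\sigma$-compact space, then the product $X\times Y$ is a star Menger space. In particular, the product of a star Menger space and a compact space is star Menger.
   Context: All spaces are assumed to be regular and $T_1$. For a family $\mathcal{U}$ of subsets of $X$ and $A\subseteq X$, $St(A,\mathcal{U})=\bigcup\{U\in\mathcal{U}:U\cap A\neq\emptyset\}$. A space $M$ is Menger if for every sequence $\{\mathcal{U}_n:n\in\omega\}$ of open covers of $M$ there are finite subcollections $\mathcal{V}_n\subseteq\mathcal{U}_n$ ($n\in\omega$) such that $\bigcup\{\mathcal{V}_n:n\in\omega\}$ is an open cover of $M$. A space $X$ is star Menger if for every open cover $\mathcal{U}$ of $X$ there is a subspace $M\subseteq X$ which is Menger and satisfies $St(M,\mathcal{U})=X$. A space is $\sigma$-compact if it is a countable union of compact subspaces. *)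

(* Defs.v *)
From mathcomp Require Import all_boot all_order all_algebra.
From mathcomp Require Import all_classical all_reals all_analysis.

Set Implicit Arguments.
Unset Strict Implicit.
Unset Printing Implicit Defensive.

Local Open Scope classical_set_scope.

Definition regular_T1 (T : topologicalType) : Prop :=
  @regular_space T /\ @accessible_space T.

Definition open_cover (T : topologicalType) (U : set (set T)) : Prop :=
  U `<=` open /\ \bigcup_(A in U) A = [set: T].

Definition star (T : Type) (A : set T) (U : set (set T)) : set T :=
  \bigcup_(B in [set B | U B /\ B `&` A !=set0]) B.

Definition menger (T : topologicalType) : Prop :=
  forall U : nat -> set (set T), (forall n, open_cover (U n)) ->
  exists V : nat -> set (set T),
    (forall n, V n `<=` U n /\ finite_set (V n)) /\
    open_cover (\bigcup_n V n).

(* [set_type M] carries the subspace topology, i.e. the initial topology of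
   the inclusion into [T]; the library's [subspace M] would be wrong here, as
   its carrier is all of [T], with the points outside [M] made isolated. *)
Definition star_menger (T : topologicalType) : Prop :=
  forall U : set (set T), open_cover U ->
  exists M : set T, menger (set_type M) /\ star M U = [set: T].

Definition sigma_compact (T : topologicalType) : Prop :=
  exists K : nat -> set T,
    (forall n, compact (K n)) /\ \bigcup_n K n = [set: T].

(* Main.v *)
(* If [K] is compact and [W] is an open cover of [X * Y], each [x] has an open
   neighbourhood [A] such that every [y] in [K] admits one member of [W]
   containing all of [A * {y}].  Applying star-Mengerness of [X] to these
   neighbourhoods yields a Menger [M] such that the star of [M * K] contains
   [X * K].  The product [M * K] is Menger by the same tube argument, and
   countable unions of Menger subspaces are Menger, so the union of the
   [M n * K n] works for a countable compact cover [K] of [Y]. *)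
Require Import Defs.
From mathcomp Require Import all_boot all_order all_algebra.
From mathcomp Require Import all_classical all_reals all_analysis.

Local Open Scope classical_set_scope.

Lemma regular_T1_prod (X Y : topologicalType) :
  regular_T1 X -> regular_T1 Y -> regular_T1 (X * Y)%type.
Proof.
move=> [rX aX] [rY aY]; split.
  move=> [x y] W /= [[A B] /= [xA yB] sW].
  have [A' xA' sA] := rX x A xA; have [B' yB' sB] := rY y B yB.
  exists (A' `*` B'); first by exists (A', B').
  move=> [x' y'] cl; apply: sW; split => /=.
    (* A point in the closure of [A' * B'] has its coordinates in the closures of [A'] and [B']:
       test the closure against cylinders over a neighbourhood of one coordinate. *)
    apply: sA => V x'V.
    have [|[a b] [[/= A'a _] [/= Va _]]] := cl (V `*` setT).
      by exists (V, setT) => //; split => //; exact: filterT.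
    by exists a.
  apply: sB => V y'V.
  have [|[a b] [[/= _ B'b] [/= _ Vb]]] := cl (setT `*` V).
    by exists (setT, V) => //; split => //; exact: filterT.
  by exists b.
move=> [x y] [x' y']; rewrite xpair_eqE negb_and => /orP[/aX|/aY] [A [oA]];
  rewrite !inE => xA x'A.
- exists (fst @^-1` A); split; rewrite ?inE //.
  by apply: open_comp => // p _; exact: cvg_fst.
- exists (snd @^-1` A); split; rewrite ?inE //.
  by apply: open_comp => // p _; exact: cvg_snd.
Qed.

(** Covering by open sets of the ambient space lets one sequence of covers serve many subsets at
    once, with no transport between subspace types. *)
Definition menger_in (T : topologicalType) (M : set T) : Prop :=
  forall U : nat -> set (set T),
    (forall n, U n `<=` open /\ M `<=` \bigcup_(A in U n) A) ->
  exists V : nat -> set (set T),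
    (forall n, V n `<=` U n /\ finite_set (V n)) /\
    M `<=` \bigcup_n \bigcup_(A in V n) A.

Lemma menger_inP (T : topologicalType) (M : set T) :
  menger (set_type M) <-> menger_in T M.
Proof.
pose tr (A : set T) : set (set_type M) := set_val @^-1` A.
split=> [mM U hU|mM U hU].
  have [|V [hV [_ cV]]] := mM (fun n => tr @` U n).
    move=> n; have [oU cU] := hU n; split.
      by move=> _ [A UA <-]; exists A => //; exact: oU.
    apply/seteqP; split => // m _.
    have [A UA Am] := cU _ (set_valP m).
    by exists (tr A) => //; exists A.
  (* Choose one ambient open set for each selected trace, so that finiteness is preserved; [set0] is
     a dummy value off [V n]. *)
  have /choice [g hg] (n : nat) : exists g : set (set_type M) -> set T,
      forall B, V n B -> U n (g B) /\ tr (g B) = B.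
    have /choice[g hg] B : exists A, V n B -> U n A /\ tr A = B.
      have [VB|nVB] := pselect (V n B); last by exists set0.
      by have [A UA <-] := (hV n).1 _ VB; exists A.
    by exists g.
  exists (fun n => g n @` V n); split.
    move=> n; split; last by apply: finite_image; exact: (hV n).2.
    by move=> _ [B VB <-]; exact: (hg n B VB).1.
  move=> x Mx; pose m : set_type M := SigSub (mem_set Mx).
  have : [set: set_type M] m by [].
  rewrite -cV => -[B [n _ VB] Bm]; exists n => //; exists (g n B).
    by exists B.
  by move: Bm; rewrite -{1}(hg n B VB).2.
(* Every open set of the subspace is the trace of an ambient one, so these lifts cover [M]. *)
have [|V [hV cV]] := mM (fun n => [set A | open A /\ U n (tr A)]).
  move=> n; have [oU cU] := hU n; split; first by move=> A [].
  move=> x Mx; pose m : set_type M := SigSub (mem_set Mx).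
  have : [set: set_type M] m by [].
  rewrite -cU => -[B UB Bm]; have [A oA AB] := oU B UB.
  by exists A; [split=> //; rewrite /tr AB|rewrite -AB in Bm].
exists (fun n => tr @` V n); split.
  move=> n; split; last by apply: finite_image; exact: (hV n).2.
  by move=> _ [A VA <-]; exact: ((hV n).1 A VA).2.
split.
  by move=> _ [n _ [A VA <-]]; apply: (hU n).1; exact: ((hV n).1 A VA).2.
apply/seteqP; split => // m _.
have [n _ [A VA Am]] := cV _ (set_valP m).
by exists (tr A) => //; exists n => //; exists A.
Qed.

(** Play [M k] against the sequence of covers delayed by [k]. Stage [n] then receives selections
    only from the finitely many [k <= n], and what [M k] selects at its own stage [n] appears at
    stage [n + k]. *)
Lemma menger_in_bigcup (T : topologicalType) (M : nat -> set T) :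
  (forall k, menger_in T (M k)) -> menger_in T (\bigcup_k M k).
Proof.
move=> mM U hU.
have /choice [V hV] (k : nat) : exists V : nat -> set (set T),
    (forall n, V n `<=` U (n + k)%N /\ finite_set (V n)) /\
    M k `<=` \bigcup_n \bigcup_(A in V n) A.
  apply: mM => n; have [oU cU] := hU (n + k)%N; split => //.
  by move=> x Mx; apply: cU; exists k.
exists (fun n => \bigcup_(k in `I_n.+1) V k (n - k)%N); split.
  move=> n; split.
    move=> A [k /= kn VA]; have := ((hV k).1 (n - k)%N).1 A VA.
    by rewrite subnK.
  by apply: bigcup_finite => // k _; exact: ((hV k).1 _).2.
move=> x [k _ Mx]; have [n _ [A VA Ax]] := (hV k).2 x Mx.
exists (n + k)%N => //; exists A => //; exists k; rewrite ?addnK //=.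
by rewrite ltnS leq_addl.
Qed.

(* Unlike in the usual tube lemma, a single [W] contains the whole slice
   [A * {y}]; the star argument needs this uniformity. *)
Lemma compact_tube (X Y : topologicalType) (K : set Y)
    (U : set (set (X * Y))) (x : X) :
  compact K -> U `<=` open ->
  (forall y, K y -> exists2 W, U W & W (x, y)) ->
  exists A F, [/\ open A, A x, finite_set F, F `<=` U &
    forall y, K y -> exists2 W, F W & forall a, A a -> W (a, y)].
Proof.
move=> cK oU cU.
pose good (B : set Y) := exists A F,
  [/\ open A, A x, finite_set F, F `<=` U &
    forall y, K y -> ~ B y -> exists2 W, F W & forall a, A a -> W (a, y)].
(* The complements of the subsets of [K] that satisfy the conclusion form a
   filter; at a cluster point, a box inside a member of [U] contradicts it. *)
have good_filter : Filter good.
  constructor.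
  - by exists setT, set0; split => //; [exact: openT|move=> y _ []].
  - move=> B C [A [F [oA Ax fF sF hF]]] [A' [F' [oA' Ax' fF' sF' hF']]].
    exists (A `&` A'), (F `|` F'); split => //.
    + exact: openI.
    + by rewrite finite_setU.
    + by rewrite subUset.
    + move=> y Ky /not_andP[/(hF _ Ky)|/(hF' _ Ky)] [W FW hW]; exists W.
      * by left.
      * by move=> a [/hW].
      * by right.
      * by move=> a [_ /hW].
  - move=> B C sBC [A [F [oA Ax fF sF hF]]]; exists A, F; split => // y Ky nC.
    by apply: hF => // /sBC.
suff [A [F [oA Ax fF sF hF]]] : good set0.
  by exists A, F; split => // y Ky; apply: hF.
apply: contrapT => good0.
have good_proper : ProperFilter good by exact: Build_ProperFilter.
have goodK : good K by exists setT, set0; split => //; exact: openT.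
have [y [Ky cly]] := cK good good_proper goodK.
have [W UW Wxy] := cU y Ky.
have [[A B] /= [xA yB] sW] : nbhs (x, y) W.
  by apply: open_nbhs_nbhs; split => //; exact: oU.
(* The single set [W] serves every [y] in [B], so the complement of [B] is in the filter, yet [y] is
   a cluster point and [B] is a neighbourhood of it. *)
have goodB : good (~` B).
  exists A^°, [set W]; split => //.
  - exact: open_interior.
  - by move=> _ ->.
  - move=> z _ /contrapT Bz; exists W => // a /interior_subset Aa.
    exact: sW.
by have [z []] := cly _ _ goodB yB.
Qed.

(** Select among the open [A] for which finitely many members of [U n] cover [A * K]; replacing each
    selected [A] by such a finite family keeps the selection finite. *)
Lemma menger_in_setX (X Y : topologicalType) (M : set X) (K : set Y) :
  menger_in X M -> compact K -> menger_in (X * Y)%type (M `*` K).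
Proof.
move=> mM cK U hU.
pose tube n (A : set X) F := [/\ finite_set F, F `<=` U n &
  forall p : X * Y, A p.1 -> K p.2 -> exists2 W, F W & W p].
have [|V [hV cV]] := mM (fun n => [set A | open A /\ exists F, tube n A F]).
  move=> n; have [oU cU] := hU n; split; first by move=> A [].
  move=> x Mx; have [|A [F [oA Ax fF sF hF]]] := @compact_tube _ _ K _ x cK oU.
    by move=> y Ky; have [//|W UW Wxy] := cU (x, y); exists W.
  exists A => //; split => //; exists F; split => // -[a y] /= Aa Ky.
  by have [W FW hW] := hF y Ky; exists W => //; exact: hW.
have /choice [G hG] (n : nat) : exists G, forall A, V n A -> tube n A (G A).
  have /choice[G hG] A : exists F, V n A -> tube n A F.
    have [VA|nVA] := pselect (V n A); last by exists set0.
    by have [_ [F hF]] := (hV n).1 A VA; exists F.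
  by exists G.
exists (fun n => \bigcup_(A in V n) G n A); split.
  move=> n; split.
    by move=> W [A /(hG n)[_ sG _]]; exact: sG.
  by apply: bigcup_finite => [|A /(hG n)[]//]; exact: (hV n).2.
move=> p [Mp Kp]; have [n _ [A VA Ap]] := cV _ Mp.
have [_ _ /(_ p Ap Kp)[W GW Wp]] := hG n A VA.
by exists n => //; exists W => //; exists A.
Qed.

Lemma star_menger_setX (X Y : topologicalType) (K : set Y)
    (U : set (set (X * Y))) :
  star_menger X -> compact K -> open_cover U ->
  exists M : set X, menger_in X M /\ [set: X] `*` K `<=` star (M `*` K) U.
Proof.
move=> smX cK [oU cU].
pose tube (A : set X) := open A /\
  forall y, K y -> exists2 W, U W & forall a, A a -> W (a, y).
have [|M [/menger_inP mM sM]] := smX tube.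
  split; first by move=> A [].
  apply/seteqP; split => // x _.
  have [y Ky|A [F [oA Ax _ sF hF]]] := @compact_tube _ _ K _ x cK oU.
    have : [set: X * Y] (x, y) by [].
    by rewrite -cU => -[W UW Wxy]; exists W.
  exists A => //; split => // y /hF[W FW hW].
  by exists W => //; exact: sF.
exists M; split => // -[x y] [_ /= Ky].
have : [set: X] x by [].
rewrite -sM => -[A /= [[_ hA] [m [Am Mm]]] Ax].
(* Both [x] and [m] lie in [A], so the same [W] contains [(x, y)] and the point [(m, y)] of
   [M * K]. *)
have [W UW hW] := hA y Ky.
exists W; last exact: hW.
by split => //; exists (m, y); split; [exact: hW|split].
Qed.

Lemma star_menger_prod_sigma_compact (X Y : topologicalType) :
  star_menger X -> sigma_compact Y -> star_menger (X * Y)%type.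
Proof.
move=> smX [K [cK cY]] U hU.
have /choice [M hM] (n : nat) := @star_menger_setX _ _ (K n) _ smX (cK n) hU.
exists (\bigcup_n (M n `*` K n)); split.
  apply/menger_inP; apply: menger_in_bigcup => n.
  by apply: menger_in_setX; [exact: (hM n).1|exact: cK].
apply/seteqP; split => // -[x y] _.
have : [set: Y] y by [].
rewrite -cY => -[n _ Ky].
have [//|W [UW [p [Wp Mp]]] Wxy] := (hM n).2 (x, y).
by exists W => //; split => //; exists p; split => //; exists n.
Qed.

Theorem proposition4p10 (X : topologicalType)
    (hX : regular_T1 X) (smX : star_menger X) :
  (forall Y : topologicalType, regular_T1 Y -> sigma_compact Y ->
     regular_T1 (X * Y)%type /\ star_menger (X * Y)%type) /\
  (forall Y : topologicalType, regular_T1 Y -> compact [set: Y] ->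
     regular_T1 (X * Y)%type /\ star_menger (X * Y)%type).
Proof.
have sigma Y : regular_T1 Y -> sigma_compact Y ->
    regular_T1 (X * Y)%type /\ star_menger (X * Y)%type.
  by split; [exact: regular_T1_prod|exact: star_menger_prod_sigma_compact].
split => // Y rY cY; apply: sigma => //.
exists (fun=> [set: Y]); split => //.
by apply/seteqP; split => // y _; exists 0%N.
Qed.
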